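(* Let $\nu$ be a generalized semiclassical weight on $\mathbb T$. Then the corresponding structure matrices $M_n$, $n\in\mathbb N$, satisfy the zero curvature formula $$T_n'-\frac1{2z}T_n=M_{n+1}T_n-T_nM_n,\qquad n\in\mathbb N .$$
   Context: $\mathbb N=\{1,2,\dots\}$, $\mathbb T=\{|z|=1\}$ (counterclockwise). $\nu$ is a positive integrable weight on $\mathbb T$ and $d\mu(z)=\frac{\nu(z)}{\mathrm i z}dz$. $\Phi_n$ is the monic polynomial of degree $n$ with $\int_{\mathbb T}\Phi_n\overline{\Phi_m}\,d\mu=\kappa_n^{-2}\delta_{n,m}$, $\kappa_n>0$; $\Phi_n^*(z)=z^n\overline{\Phi_n(1/\bar z)}$; $\alpha_{n-1}=-\overline{\Phi_n(0)}$ ($n\ge1$); $b_n=2\pi\kappa_n^2$. For $z\notin\mathbb T$, $$G_n(z)=\frac1{2\pi \mathrm i}\int_{\mathbb T}\frac{\Phi_n(t)}{t-z}\frac{\nu(t)}{t^n}dt,\quad G_{n-1}^*(z)=\frac1{2\pi \mathrm i}\int_{\mathbb T}\frac{\Phi_{n-1}^*(t)}{t-z}\frac{\nu(t)}{t^n}dt,\quad Y_n=\begin{bmatrix}\Phi_n&G_n\\-b_{n-1}\Phi_{n-1}^*&-b_{n-1}G_{n-1}^*\end{bmatrix}\quad(n\in\mathbb N),$$ and the transfer matrix is $$T_n(z)=\begin{bmatrix}z+\overline{\alpha}_n\alpha_{n-1}&\overline{\alpha}_n/b_n\\ \alpha_{n-1}b_n&1\end{bmatrix}.$$ Generalized semiclassical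 weight: $\nu$ satisfies $zA(z)\nu'(z)=q(z)\nu(z)$ off the set $\mathcal Z_A$ of zeros of $zA(z)$, where $A$ is a (nonzero) polynomial and $q$ is entire. Off $\mathcal Z_A$, $\nu$ denotes the (possibly multivalued, nonvanishing) analytic function determined by this equation and the weight on $\mathbb T\setminus \mathcal Z_A$. $C_n(z)=\operatorname{diag}\big(z^{-n/2}\nu(z)^{1/2},\,z^{n/2}\nu(z)^{-1/2}\big)$, $Z_n=Y_nC_n$, $M_n=Z_n'Z_n^{-1}$ (structure matrix). Local analytic branches are used for the powers; $C_n'C_n^{-1}=\big(-\frac n{2z}+\frac{q(z)}{2zA(z)}\big)\operatorname{diag}(1,-1)$ and $M_n$ do not depend on the branches and are single valued on $\mathbb C\setminus(\mathbb T\cup\mathcal Z_A)$, where the formula is understood to hold. *)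

(* Defs.v *)
From HB Require Import structures.
From mathcomp Require Import all_boot all_order all_algebra.
From mathcomp Require Import complex.
From mathcomp Require Import all_classical all_reals all_analysis.

Set Implicit Arguments.
Unset Strict Implicit.
Unset Printing Implicit Defensive.

Import Order.TTheory GRing.Theory Num.Theory numFieldNormedType.Exports.
Local Open Scope classical_set_scope.
Local Open Scope complex_scope.
Local Open Scope ring_scope.

(* R[i] seen through numClosedFieldType, so that it carries the topology and
   the normed module structure of a numFieldType; derivatives of functions
   cplx R -> cplx R are complex derivatives, and the norm is cplx R-valued. *)
Definition cplx (R : realType) : numClosedFieldType := R[i].

Definition ofR {R : realType} (x : R) : cplx R := x%:C.

Definition iC {R : realType} : cplx R := 0 +i* 1.

Definition mx2 {R : realType} (a b c d : cplx R) : 'M[cplx R]_2 :=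
  \matrix_(i < 2, j < 2) nth 0 (nth [::] [:: [:: a; b]; [:: c; d]] i) j.

Definition mxderive1 {R : realType} (F : cplx R -> 'M[cplx R]_2) (z : cplx R) :
    'M[cplx R]_2 :=
  \matrix_(i < 2, j < 2) derive1 (fun u => F u i j : cplx R) z.

(** * Integration over the unit circle *)

Definition expi {R : realType} (x : R) : cplx R := cos x +i* sin x.

Definition arcT {R : realType} : set R := `[0, 2 * pi]%classic.

Definition cintegral {R : realType} (g : R -> cplx R) : cplx R :=
  (\int[lebesgue_measure]_(x in arcT) complex.Re (g x))
  +i* (\int[lebesgue_measure]_(x in arcT) complex.Im (g x)).

(* \int_T f(t) dt, with t = exp(i x) and dt = i exp(i x) dx. *)
Definition intT {R : realType} (f : cplx R -> cplx R) : cplx R :=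
  cintegral (fun x : R => f (expi x) * (iC * expi x)).

Definition int_mu {R : realType} (nu : cplx R -> R) (f : cplx R -> cplx R) :
    cplx R :=
  intT (fun z => f z * (ofR (nu z) / (iC * z))).

(* Only the values of nu on the circle matter. Positivity is required almost
   everywhere, as a semiclassical weight may vanish or blow up at the zeros
   of A on the circle. *)
Definition weightT {R : realType} (nu : cplx R -> R) : Prop :=
  lebesgue_measure.-integrable (@arcT R) (EFin \o (fun x : R => nu (expi x)))
  /\ {ae lebesgue_measure, forall x : R, arcT x -> 0 < nu (expi x)}.

(** * Orthogonal polynomials on the unit circle *)

Definition is_MOPUC {R : realType} (nu : cplx R -> R)
    (Phi : nat -> {poly cplx R}) (kappa : nat -> R) : Prop :=
  [/\ forall n, Phi n \is monic /\ size (Phi n) = n.+1,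
      forall n, 0 < kappa n
    & forall n m, int_mu nu (fun z => (Phi n).[z] * ((Phi m).[z])^*) =
                  if n == m then ofR (kappa n ^- 2) else 0].

(* The value at z = 0 is not the usual one (the inverse of 0 is 0); z = 0 is
   a zero of z A(z), hence excluded below. *)
Definition Phistar {R : realType} (Phi : nat -> {poly cplx R}) (n : nat)
    (z : cplx R) : cplx R :=
  z ^+ n * ((Phi n).[(z^*)^-1])^*.

(* alpha_n, i.e. alpha_{n-1} = - conj (Phi_n(0)) for n >= 1. *)
Definition verblunsky {R : realType} (Phi : nat -> {poly cplx R}) (n : nat) :
    cplx R :=
  - ((Phi n.+1).[0])^*.

Definition bcoef {R : realType} (kappa : nat -> R) (n : nat) : cplx R :=
  ofR (2 * pi * kappa n ^+ 2).

Definition cauchyT {R : realType} (f : cplx R -> cplx R) (z : cplx R) :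
    cplx R :=
  (2 * ofR pi * iC)^-1 * intT (fun t => f t / (t - z)).

Definition Gfun {R : realType} (nu : cplx R -> R)
    (Phi : nat -> {poly cplx R}) (n : nat) : cplx R -> cplx R :=
  cauchyT (fun t => (Phi n).[t] * (ofR (nu t) / t ^+ n)).

(* Note the exponent: G*_{n-1} is defined with t^n in the denominator. *)
Definition Gstar {R : realType} (nu : cplx R -> R)
    (Phi : nat -> {poly cplx R}) (n : nat) : cplx R -> cplx R :=
  cauchyT (fun t => Phistar Phi n t * (ofR (nu t) / t ^+ n.+1)).

(* Ymx and Tmx are meant for n >= 1. *)
Definition Ymx {R : realType} (nu : cplx R -> R) (Phi : nat -> {poly cplx R})
    (kappa : nat -> R) (n : nat) (z : cplx R) : 'M[cplx R]_2 :=
  mx2 (Phi n).[z]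
      (Gfun nu Phi n z)
      (- bcoef kappa n.-1 * Phistar Phi n.-1 z)
      (- bcoef kappa n.-1 * Gstar nu Phi n.-1 z).

Definition Tmx {R : realType} (Phi : nat -> {poly cplx R}) (kappa : nat -> R)
    (n : nat) (z : cplx R) : 'M[cplx R]_2 :=
  let a := verblunsky Phi in
  let b := bcoef kappa in
  mx2 (z + (a n)^* * a n.-1) ((a n)^* / b n)
      (a n.-1 * b n)         1.

(** * Generalized semiclassical weights *)

Definition entire {R : realType} (q : cplx R -> cplx R) : Prop :=
  forall z, derivable q z 1.

Definition disc {R : realType} (c : cplx R) (r : R) : set (cplx R) :=
  ball c (ofR r).

Definition zerosZ {R : realType} (A : {poly cplx R}) : set (cplx R) :=
  [set z | z * A.[z] = 0].

Definition pearson_on {R : realType} (A : {poly cplx R})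
    (q : cplx R -> cplx R) (c : cplx R) (r : R) (f : cplx R -> cplx R) :
    Prop :=
  0 < r /\
  forall u, disc c r u ->
    [/\ ~ zerosZ A u, derivable f u 1, f u != 0
      & u * A.[u] * derive1 f u = q u * f u].

Definition extends_weight {R : realType} (nu : cplx R -> R) (c : cplx R)
    (r : R) (f : cplx R -> cplx R) : Prop :=
  forall t, disc c r t -> `|t| = 1 -> f t = ofR (nu t).

(* nu_branch nu A q c r f: on the disc of centre c and radius r, f is a branch
   of the multivalued analytic function nu, i.e. it is obtained from the weight
   on the circle by analytic continuation along a chain of discs avoiding
   zerosZ A. *)
Inductive nu_branch {R : realType} (nu : cplx R -> R) (A : {poly cplx R})
    (q : cplx R -> cplx R) :
    cplx R -> R -> (cplx R -> cplx R) -> Prop :=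
| nu_branch_start c r f :
    `|c| = 1 -> pearson_on A q c r f -> extends_weight nu c r f ->
    nu_branch nu A q c r f
| nu_branch_step c r f c' r' f' :
    nu_branch nu A q c r f -> pearson_on A q c' r' f' ->
    disc c r `&` disc c' r' !=set0 ->
    (forall u, disc c r u -> disc c' r' u -> f' u = f u) ->
    nu_branch nu A q c' r' f'.

Definition gen_semiclassical {R : realType} (nu : cplx R -> R)
    (A : {poly cplx R}) (q : cplx R -> cplx R) : Prop :=
  [/\ A != 0, entire q
    & forall t : cplx R, `|t| = 1 -> ~ zerosZ A t ->
        exists r f, pearson_on A q t r f /\ extends_weight nu t r f].

(** * Structure matrices *)

Definition sqrt_branch_on {R : realType} (c : cplx R) (r : R)
    (f s : cplx R -> cplx R) : Prop :=
  forall u, disc c r u -> derivable s u 1 /\ s u ^+ 2 = f u.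

(* h and s stand for local branches of z^(1/2) and of nu(z)^(1/2). *)
Definition Cmx {R : realType} (h s : cplx R -> cplx R) (n : nat)
    (z : cplx R) : 'M[cplx R]_2 :=
  mx2 (h z ^- n * s z) 0
      0                (h z ^+ n / s z).

Definition Zmx {R : realType} (nu : cplx R -> R) (Phi : nat -> {poly cplx R})
    (kappa : nat -> R) (h s : cplx R -> cplx R) (n : nat) (z : cplx R) :
    'M[cplx R]_2 :=
  Ymx nu Phi kappa n z *m Cmx h s n z.

(* M is the value at z of Z_n' Z_n^{-1}, computed with some local branches
   around z; it does not depend on the branches. *)
Definition is_structure_matrix {R : realType} (nu : cplx R -> R)
    (A : {poly cplx R}) (q : cplx R -> cplx R) (Phi : nat -> {poly cplx R})
    (kappa : nat -> R) (n : nat) (z : cplx R) (M : 'M[cplx R]_2) : Prop :=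
  exists (c : cplx R) (r : R) (f h s : cplx R -> cplx R),
    [/\ nu_branch nu A q c r f, disc c r z,
        sqrt_branch_on c r id h, sqrt_branch_on c r f s
      & M = mxderive1 (Zmx nu Phi kappa h s n) z
            *m invmx (Zmx nu Phi kappa h s n z)].

(* Main.v *)
(** With [D(z) = diag(1, z)], the Szego recurrences, which follow from
    orthogonality alone, and the relation [z/(t - z) = t/(t - z) - 1] under the
    Cauchy integrals give [Y_{n+1} D = T_n Y_n] off the circle.  Since
    [det T_n = z], this propagates [det Y_n = 1] from [n = 1].  The logarithmic
    derivative of [C_n] is [theta_n sigma] with [sigma = diag(1, -1)] and
    [theta_n = -n/(2z) + q/(2zA)], so that
    [M_n Y_n = Y_n' + theta_n Y_n sigma] whatever the branches.  Differentiating
    [Y_{n+1} D = T_n Y_n] and using [theta_{n+1} - theta_n = -1/(2z)] and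
    [D' + D sigma / (2z) = D / (2z)] yields the formula after multiplication by
    [Y_n], which is invertible. *)

Require Import Defs.
From HB Require Import structures.
From mathcomp Require Import all_boot all_order all_algebra.
From mathcomp Require Import complex.
From mathcomp Require Import ring.
From mathcomp Require Import all_classical all_reals all_analysis.
Set Implicit Arguments.
Unset Strict Implicit.
Unset Printing Implicit Defensive.

Import Order.TTheory GRing.Theory Num.Theory numFieldNormedType.Exports.
Local Open Scope ring_scope.

(** * Complex arithmetic through real and imaginary parts *)

Lemma ReM (R : realType) (x y : cplx R) :
  complex.Re (x * y) = complex.Re x * complex.Re y - complex.Im x * complex.Im y.
Proof. by case: x; case: y. Qed.

Lemma ImM (R : realType) (x y : cplx R) :
  complex.Im (x * y) = complex.Re x * complex.Im y + complex.Im x * complex.Re y.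
Proof. by case: x; case: y. Qed.

Lemma ReD (R : realType) (x y : cplx R) :
  complex.Re (x + y) = complex.Re x + complex.Re y.
Proof. by case: x; case: y. Qed.

Lemma ImD (R : realType) (x y : cplx R) :
  complex.Im (x + y) = complex.Im x + complex.Im y.
Proof. by case: x; case: y. Qed.

Lemma ReV (R : realType) (x : cplx R) :
  complex.Re x^-1 = complex.Re x / (complex.Re x ^+ 2 + complex.Im x ^+ 2).
Proof. by case: x. Qed.

Lemma ImV (R : realType) (x : cplx R) :
  complex.Im x^-1 = - complex.Im x / (complex.Re x ^+ 2 + complex.Im x ^+ 2).
Proof. by case: x => a b /=; rewrite mulNr. Qed.

Lemma Re_conj (R : realType) (x : cplx R) : complex.Re x^* = complex.Re x.
Proof. by case: x. Qed.

Lemma Im_conj (R : realType) (x : cplx R) : complex.Im x^* = - complex.Im x.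
Proof. by case: x. Qed.

Lemma cplx_eq (R : realType) (x y : cplx R) :
  complex.Re x = complex.Re y -> complex.Im x = complex.Im y -> x = y.
Proof. by case: x => a b; case: y => c d /= -> ->. Qed.

Lemma ofRM (R : realType) (x y : R) : ofR (x * y) = ofR x * ofR y.
Proof. exact: rmorphM. Qed.

Lemma ofRV (R : realType) (x : R) : ofR x^-1 = (ofR x)^-1.
Proof. exact: fmorphV. Qed.

Lemma norm_le_ReIm (R : realType) (x : cplx R) :
  `|x| <= ofR (`|complex.Re x| + `|complex.Im x|).
Proof.
set r := _ + _; have r0 : 0 <= r by rewrite addr_ge0.
rewrite normc_def lecR -(ger0_norm r0) -sqrtr_sqr.
by rewrite ler_wsqrtr // sqrrD !real_normK ?num_real // addrAC lerDl mulrn_wge0 ?mulr_ge0.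
Qed.

Lemma norm_Re_Im_le (R : realType) (x : cplx R) (B : R) : `|x| <= ofR B ->
  `|complex.Re x| <= B /\ `|complex.Im x| <= B.
Proof.
move=> xB; split; rewrite -lecR; first exact: le_trans (normc_ge_Re _) xB.
apply: le_trans xB; rewrite normc_def lecR -sqrtr_sqr ler_wsqrtr //.
by rewrite lerDr sqr_ge0.
Qed.

Lemma norm_expi (R : realType) (x : R) : `|expi x| = 1.
Proof.
have := add_Re2_Im2 (expi x : R[i]); rewrite /= cos2Dsin2 => /esym h.
by apply/eqP; rewrite -(@eqrXn2 _ 2) // h expr1n.
Qed.

Lemma expi_neq0 (R : realType) (x : R) : expi x != 0.
Proof. by rewrite -normr_eq0 norm_expi oner_neq0. Qed.

(* Phrased with real functions of the angle, which is what the integrability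
   and boundedness lemmas over [0, 2 pi] consume. *)
Definition circle_continuous {R : realType} (f : cplx R -> cplx R) : Prop :=
  continuous (fun x : R => complex.Re (f (expi x))) /\
  continuous (fun x : R => complex.Im (f (expi x))).

(** * Functions continuous on the unit circle *)

Section CircleContinuous.
Local Open Scope classical_set_scope.
Variable R : realType.
Implicit Types f g : cplx R -> cplx R.

Lemma circle_continuous_cst (c : cplx R) : circle_continuous (fun=> c).
Proof. by split=> x; exact: cvg_cst. Qed.

Lemma circle_continuous_id : circle_continuous (fun t : cplx R => t).
Proof. by split=> x /=; [exact: continuous_cos | exact: continuous_sin]. Qed.

Lemma circle_continuousD f g : circle_continuous f -> circle_continuous g ->
  circle_continuous (fun t => f t + g t).
Proof.
case=> f1 f2 [g1 g2]; split.
- under eq_fun do rewrite ReD; move=> x; exact: cvgD (f1 x) (g1 x).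
- under eq_fun do rewrite ImD; move=> x; exact: cvgD (f2 x) (g2 x).
Qed.

Lemma circle_continuousM f g : circle_continuous f -> circle_continuous g ->
  circle_continuous (fun t => f t * g t).
Proof.
case=> f1 f2 [g1 g2]; split.
- under eq_fun do rewrite ReM; move=> x.
  by apply: cvgB; apply: cvgM; [exact: f1|exact: g1|exact: f2|exact: g2].
- under eq_fun do rewrite ImM; move=> x.
  by apply: cvgD; apply: cvgM; [exact: f1|exact: g2|exact: f2|exact: g1].
Qed.

Lemma circle_continuousN f : circle_continuous f ->
  circle_continuous (fun t => - f t).
Proof.
move=> hf; under [X in circle_continuous X]eq_fun do rewrite -mulN1r.
exact: circle_continuousM (circle_continuous_cst _) hf.
Qed.

Lemma circle_continuousB f g : circle_continuous f -> circle_continuous g ->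
  circle_continuous (fun t => f t - g t).
Proof. by move=> hf hg; apply/circle_continuousD => //; exact/circle_continuousN. Qed.

Lemma circle_continuousX f n : circle_continuous f ->
  circle_continuous (fun t => f t ^+ n).
Proof.
move=> hf; elim: n => [|n IH].
  by under [X in circle_continuous X]eq_fun do rewrite expr0;
    exact: circle_continuous_cst.
by under [X in circle_continuous X]eq_fun do rewrite exprS;
  exact: circle_continuousM.
Qed.

Lemma circle_continuous_conj f : circle_continuous f ->
  circle_continuous (fun t => (f t)^*).
Proof.
case=> f1 f2; split; first by under eq_fun do rewrite Re_conj.
under eq_fun do rewrite Im_conj; move=> x; exact: cvgN (f2 x).
Qed.

Lemma circle_continuousV f : (forall x, f (expi x) != 0) ->
  circle_continuous f -> circle_continuous (fun t => (f t)^-1).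
Proof.
move=> fn0 [f1 f2].
have n0 x : complex.Re (f (expi x)) ^+ 2 + complex.Im (f (expi x)) ^+ 2 != 0.
  rewrite paddr_eq0 ?sqr_ge0 // !sqrf_eq0; apply: contra (fn0 x).
  by case: (f _) => a b /= /andP[/eqP -> /eqP ->].
have nV : continuous (fun x => (complex.Re (f (expi x)) ^+ 2 +
                               complex.Im (f (expi x)) ^+ 2)^-1).
  move=> x; apply: cvgV; first exact: n0.
  by apply: cvgD; [exact: cvgM (f1 x) (f1 x)|exact: cvgM (f2 x) (f2 x)].
split.
- under eq_fun do rewrite ReV; move=> x.
  exact: cvgM (f1 x) (nV x).
- under eq_fun do rewrite ImV; move=> x.
  exact: cvgM (cvgN (f2 x)) (nV x).
Qed.

Lemma circle_continuous_horner (p : {poly cplx R}) :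
  circle_continuous (fun t => p.[t]).
Proof.
elim/poly_ind: p => [|p c IH].
  under [X in circle_continuous X]eq_fun do rewrite horner0.
  exact: circle_continuous_cst.
under [X in circle_continuous X]eq_fun do rewrite hornerD hornerMX hornerC.
apply: circle_continuousD (circle_continuous_cst _).
exact: circle_continuousM IH circle_continuous_id.
Qed.

Lemma circle_continuous_bounded f : circle_continuous f ->
  exists2 B : R, 0 < B & forall x, arcT x ->
    `|f (expi x)| <= ofR B.
Proof.
have bnd (g : R -> R) : continuous g ->
    exists2 B : R, 0 < B & forall x, arcT x -> `|g x| <= B.
  move=> gc; have /compact_bounded : compact (g @` arcT).
    apply: continuous_compact; last exact: segment_compact.
    exact: continuous_subspaceT.
  (* The bound is available for every constant strictly above [B]; [|B| + 1] is one that is also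
     positive. *)
  case=> B [_ hB]; exists (`|B| + 1); first by rewrite ltr_wpDl.
  by move=> x xT; apply: hB; [rewrite (le_lt_trans (ler_norm _)) ?ltrDl|exists x].
move=> [/bnd[B1 B1p h1] /bnd[B2 B2p h2]]; exists (B1 + B2); first exact: addr_gt0.
move=> x xT; apply: le_trans (norm_le_ReIm _) _.
by rewrite lecR lerD ?h1 ?h2.
Qed.

(** A bounded measurable factor keeps an integrable function integrable. Nothing else is asked of
    [nu], which may be unbounded near zeros of [A] on the circle. *)
Lemma circle_continuous_integrable (nu : cplx R -> R) f :
  lebesgue_measure.-integrable (@arcT R) (EFin \o (fun x : R => nu (expi x))) ->
  circle_continuous f ->
  lebesgue_measure.-integrable (@arcT R)
    (EFin \o (fun x => complex.Re (f (expi x)) * nu (expi x))) /\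
  lebesgue_measure.-integrable (@arcT R)
    (EFin \o (fun x => complex.Im (f (expi x)) * nu (expi x))).
Proof.
move=> inu fc; have [B _ hB] := circle_continuous_bounded fc.
have mT : measurable (@arcT R) by exact: measurable_itv.
have [f1 f2] := fc.
have key (g : R -> R) : continuous g -> (forall x, arcT x -> `|g x| <= B) ->
    lebesgue_measure.-integrable (@arcT R) (EFin \o (fun x => g x * nu (expi x))).
  move=> gc gB.
  have := @integrableMr _ _ _ lebesgue_measure _ mT g _ _ _ inu.
  apply.
    by apply: measurable_funS (measurable_realfun.continuous_measurable_fun gc).
  exists B; split; first exact: num_real.
  by move=> y By x xT; apply: le_trans (gB _ xT) (ltW By).
split; apply: key => // x xT; by case: (norm_Re_Im_le (hB x xT)).
Qed.

End CircleContinuous.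

(** * Integration against the measure mu *)

Section CircleFunctional.
Local Open Scope classical_set_scope.
Variables (R : realType) (nu : cplx R -> R).
Implicit Types f g : cplx R -> cplx R.
Local Open Scope complex_scope.
Local Open Scope ring_scope.

Lemma iC_neq0 : iC != 0 :> cplx R.
Proof. by apply/eqP; case=> /eqP; rewrite oner_eq0. Qed.

(** The denominator [iC * z] of the density cancels the factor coming from dt = i t dx, so mu is the
    real measure nu(exp(i x)) dx in the angle x. *)
Lemma int_mu_cintegral f :
  int_mu nu f = cintegral (fun x => f (expi x) * ofR (nu (expi x))).
Proof.
congr (cintegral _); apply/funext => x.
by rewrite -mulrA mulfVK // mulf_neq0 ?iC_neq0 ?expi_neq0.
Qed.

Lemma int_muE f : int_mu nu f =
  (\int[lebesgue_measure]_(x in arcT) (complex.Re (f (expi x)) * nu (expi x)))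
  +i* (\int[lebesgue_measure]_(x in arcT) (complex.Im (f (expi x)) * nu (expi x))).
Proof.
rewrite int_mu_cintegral; congr (_ +i* _); apply: eq_Rintegral => x _.
  by rewrite ReM /= mulr0 subr0.
by rewrite ImM /= mulr0 add0r.
Qed.

Lemma eq_int_mu f g : (forall t, `|t| = 1 -> f t = g t) ->
  int_mu nu f = int_mu nu g.
Proof.
move=> fg; rewrite !int_mu_cintegral; congr cintegral; apply/funext => x.
by rewrite fg // norm_expi.
Qed.

Lemma int_mu_conj f : circle_continuous f ->
  lebesgue_measure.-integrable (@arcT R) (EFin \o (fun x : R => nu (expi x))) ->
  int_mu nu (fun t => (f t)^*) = (int_mu nu f)^*.
Proof.
move=> fc inu; have [i1 i2] := circle_continuous_integrable inu fc.
rewrite !int_muE; apply: cplx_eq; rewrite /=.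
  by apply: eq_Rintegral => x _; rewrite Re_conj.
rewrite -mulN1r -RintegralZl //; last exact: measurable_itv.
by apply: eq_Rintegral => x _; rewrite Im_conj mulrA mulN1r.
Qed.

Hypothesis inu :
  lebesgue_measure.-integrable (@arcT R) (EFin \o (fun x : R => nu (expi x))).

Lemma int_muD f g : circle_continuous f -> circle_continuous g ->
  int_mu nu (fun t => f t + g t) = int_mu nu f + int_mu nu g.
Proof.
move=> fc gc; have [f1 f2] := circle_continuous_integrable inu fc.
have [g1 g2] := circle_continuous_integrable inu gc.
have mT : measurable (@arcT R) by exact: measurable_itv.
rewrite !int_muE; apply: cplx_eq; rewrite /= -RintegralD //;
  by apply: eq_Rintegral => x _; rewrite ?ReD ?ImD mulrDl.
Qed.

Lemma int_muZ c f : circle_continuous f ->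
  int_mu nu (fun t => c * f t) = c * int_mu nu f.
Proof.
move=> fc; have [f1 f2] := circle_continuous_integrable inu fc.
have mT : measurable (@arcT R) by exact: measurable_itv.
have iZ (r : R) (h : R -> R) : lebesgue_measure.-integrable (@arcT R) (EFin \o h) ->
    lebesgue_measure.-integrable (@arcT R) (EFin \o (fun x => r * h x)).
  by move=> ih; exact: (@integrableZl _ _ _ lebesgue_measure _ mT r _ ih).
rewrite !int_muE; apply: cplx_eq; rewrite ?ReM ?ImM /= -!RintegralZl //.
  rewrite -RintegralB //; [|exact: iZ..].
  by apply: eq_Rintegral => x _; rewrite ReM mulrBl !mulrA.
rewrite -RintegralD //; [|exact: iZ..].
by apply: eq_Rintegral => x _; rewrite ImM mulrDl !mulrA.
Qed.

Lemma int_muN f : circle_continuous f ->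
  int_mu nu (fun t => - f t) = - int_mu nu f.
Proof.
move=> fc; rewrite -mulN1r -int_muZ //; congr int_mu; apply/funext => t.
by rewrite mulN1r.
Qed.

Lemma int_muB f g : circle_continuous f -> circle_continuous g ->
  int_mu nu (fun t => f t - g t) = int_mu nu f - int_mu nu g.
Proof. by move=> fc gc; rewrite int_muD ?int_muN //; exact: circle_continuousN. Qed.

(** The constant is twice the integral of |nu|, once for the real part and once for the imaginary
    part. It serves all [f] and [B] at once, as needed for estimates uniform in the increment of a
    difference quotient. *)
Lemma int_mu_bound : exists2 N : R, 0 <= N & forall f (B : R),
  circle_continuous f -> (forall x, arcT x -> `|f (expi x)| <= ofR B) ->
  `|int_mu nu f| <= ofR (B * N).
Proof.
have mT : measurable (@arcT R) by exact: measurable_itv.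
have iN : lebesgue_measure.-integrable (@arcT R)
    (EFin \o (fun x : R => `|nu (expi x)|)) by exact: integrable_norm.
pose N := \int[lebesgue_measure]_(x in @arcT R) `|nu (expi x)|.
have N0 : 0 <= N by apply: Rintegral_ge0.
exists (2 * N); first exact: mulr_ge0.
move=> f B fc fB; have [f1 f2] := circle_continuous_integrable inu fc.
have key (g : R -> R) : lebesgue_measure.-integrable (@arcT R)
     (EFin \o (fun x => g x * nu (expi x))) -> (forall x, arcT x -> `|g x| <= B) ->
   `|\int[lebesgue_measure]_(x in arcT) (g x * nu (expi x))| <= B * N.
  move=> ig gB; apply: (le_trans (@le_normr_Rintegral _ _ _ lebesgue_measure _ _ mT ig)).
  rewrite -RintegralZl //; apply: le_Rintegral => //.
  - exact: integrable_norm.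
  - exact: (@integrableZl _ _ _ lebesgue_measure _ mT B _ iN).
  - by move=> x xT; rewrite normrM ler_wpM2r // gB.
rewrite int_muE; set a := Rintegral _ _ _; set b := Rintegral _ _ _.
apply: (le_trans (norm_le_ReIm _)).
have -> : B * (2 * N) = B * N + B * N by ring.
by rewrite lecR lerD // key // => x /fB/norm_Re_Im_le[].
Qed.

End CircleFunctional.

(** * Reversed polynomials *)

Section ReversePolynomial.
Variable R : realType.
Implicit Types (p q : {poly cplx R}) (t : cplx R).

(* [revpoly n (Phi n)] is [Phistar Phi n] as a polynomial, including at 0. *)
Definition revpoly (m : nat) p : {poly cplx R} :=
  \poly_(i < m.+1) (p`_(m - i))^*.

Lemma size_revpoly m p : (size (revpoly m p) <= m.+1)%N.
Proof. exact: size_poly. Qed.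

(** Reversing the summation index turns t^(m-i) into t^m t^(-i), which requires t nonzero. *)
Lemma horner_revpoly m p t : t != 0 -> (size p <= m.+1)%N ->
  (revpoly m p).[t] = t ^+ m * (p.[(t^*)^-1])^*.
Proof.
move=> t0 sp; rewrite horner_poly (horner_coef_wide _ sp).
rewrite rmorph_sum mulr_sumr (reindex_inj rev_ord_inj); apply: eq_bigr => i _ /=.
have im : (i <= m)%N by rewrite -ltnS ltn_ord.
rewrite subSS subKn // rmorphM rmorphXn fmorphV /= conjCK mulrCA; congr (_ * _).
by rewrite exprVn expfB_cond // (negPf t0).
Qed.

Lemma circle_conjV t : `|t| = 1 -> (t^*)^-1 = t.
Proof. by move=> t1; rewrite invC_norm conjCK norm_conjC t1 expr1n invr1 mul1r. Qed.

Lemma circle_neq0 t : `|t| = 1 -> t != 0.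
Proof. by move=> t1; rewrite -normr_eq0 t1 oner_neq0. Qed.

Lemma horner_revpoly_circle m p t : `|t| = 1 -> (size p <= m.+1)%N ->
  (revpoly m p).[t] = t ^+ m * (p.[t])^*.
Proof. by move=> t1 sp; rewrite horner_revpoly ?circle_neq0 // circle_conjV. Qed.

(** The integers 1, ..., [size (p - q)] are distinct and nonzero, and they would be too many roots
    for a nonzero difference. This lets identities be checked away from 0, where [horner_revpoly]
    applies. *)
Lemma poly_ext_neq0 p q : (forall z, z != 0 -> p.[z] = q.[z]) -> p = q.
Proof.
move=> pq; apply/eqP; rewrite -subr_eq0; apply: contraT => pq0.
pose s := [seq i.+1%:R | i <- iota 0 (size (p - q))] : seq (cplx R).
have us : uniq s by rewrite map_inj_uniq ?iota_uniq // => i j /eqP; rewrite eqr_nat => /eqP[].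
have rs : all (root (p - q)) s.
  by apply/allP => _ /mapP[i _ ->]; rewrite /root hornerD hornerN pq ?subrr ?pnatr_eq0.
by have := max_poly_roots pq0 rs us; rewrite size_map size_iota ltnn.
Qed.

End ReversePolynomial.

(** * Orthogonality and the Szego recurrences *)

Section Szego.
Local Open Scope classical_set_scope.
Local Open Scope ring_scope.
Variables (R : realType) (nu : cplx R -> R).
Variables (Phi : nat -> {poly cplx R}) (kappa : nat -> R).
Hypothesis hnu : weightT nu.
Hypothesis hPhi : is_MOPUC nu Phi kappa.
Implicit Types p q r : {poly cplx R}.

Let inu := hnu.1.

Definition inner_mu p q : cplx R := int_mu nu (fun z => p.[z] * (q.[z])^*).

Local Notation "<( p , q )>" := (inner_mu p q).

Lemma circle_continuous_inner p q :
  circle_continuous (fun t : cplx R => p.[t] * (q.[t])^*).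
Proof.
apply: circle_continuousM; first exact: circle_continuous_horner.
exact/circle_continuous_conj/circle_continuous_horner.
Qed.

Lemma inner_muC p q : <(q, p)> = <(p, q)>^*.
Proof.
rewrite -int_mu_conj //; last exact: circle_continuous_inner.
by apply: eq_int_mu => t _; rewrite rmorphM /= conjCK mulrC.
Qed.

Lemma inner_muDl p q r : <(p + q, r)> = <(p, r)> + <(q, r)>.
Proof.
rewrite -int_muD //; try exact: circle_continuous_inner.
by apply: eq_int_mu => t _; rewrite hornerD mulrDl.
Qed.

Lemma inner_muZl c p r : <(c *: p, r)> = c * <(p, r)>.
Proof.
rewrite -int_muZ //; try exact: circle_continuous_inner.
by apply: eq_int_mu => t _; rewrite hornerZ mulrA.
Qed.

Lemma inner_muNl p r : <(- p, r)> = - <(p, r)>.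
Proof. by rewrite -scaleN1r inner_muZl mulN1r. Qed.

Lemma inner_muBl p q r : <(p - q, r)> = <(p, r)> - <(q, r)>.
Proof. by rewrite inner_muDl inner_muNl. Qed.

Lemma inner_muDr p q r : <(r, p + q)> = <(r, p)> + <(r, q)>.
Proof. by rewrite inner_muC inner_muDl rmorphD /= -!inner_muC. Qed.

Lemma inner_muZr c p r : <(r, c *: p)> = c^* * <(r, p)>.
Proof. by rewrite inner_muC inner_muZl rmorphM /= -inner_muC. Qed.

Lemma inner_muX p q : <('X * p, 'X * q)> = <(p, q)>.
Proof.
apply: eq_int_mu => t t1; rewrite !hornerM !hornerX rmorphM /= mulrACA.
by rewrite -normCK t1 expr1n mul1r.
Qed.

(** On the circle reversal is conjugation followed by multiplication by the unimodular t^m, so it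
    preserves norms and swaps the two arguments. *)
Lemma inner_mu_rev m p q : (size p <= m.+1)%N -> (size q <= m.+1)%N ->
  <(revpoly m p, revpoly m q)> = <(q, p)>.
Proof.
move=> sp sq; apply: eq_int_mu => t t1.
rewrite !horner_revpoly_circle // rmorphM rmorphXn /= mulrACA conjCK -exprMn.
by rewrite -normCK t1 !expr1n mul1r mulrC.
Qed.

Lemma Phi_monic n : Phi n \is monic. Proof. by case: hPhi => /(_ n)[]. Qed.

Lemma size_Phi n : size (Phi n) = n.+1. Proof. by case: hPhi => /(_ n)[]. Qed.

Lemma kappa_neq0 n : ofR (kappa n) != 0.
Proof.
case: hPhi => _ /(_ n) k0 _; apply/eqP => /complexI k1.
by rewrite k1 ltxx in k0.
Qed.

Lemma inner_Phi n m : <(Phi n, Phi m)> = if n == m then ofR (kappa n) ^- 2 else 0.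
Proof.
case: hPhi => _ _ /(_ n m); rewrite /inner_mu => ->; case: eqP => // _.
by rewrite /ofR -rmorphXn -fmorphV.
Qed.

Lemma Phi_coef n : (Phi n)`_n = 1.
Proof. by have /monicP := Phi_monic n; rewrite lead_coefE size_Phi. Qed.

Lemma size_sub_monic (n : nat) p q : (size p <= n.+1)%N -> (size q <= n.+1)%N ->
  p`_n = q`_n -> (size (p - q)%R <= n)%N.
Proof.
move=> sp sq pq; apply/leq_sizeP => j; rewrite leq_eqVlt => /predU1P[<-|nj].
  by rewrite coefB pq subrr.
by rewrite coefB !nth_default ?subrr // (leq_trans _ nj).
Qed.

Lemma size_sub_Phi n p : (size p <= n.+1)%N ->
  (size (p - p`_n *: Phi n)%R <= n)%N.
Proof.
move=> sp; apply: size_sub_monic => //.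
  by rewrite (leq_trans (size_scale_leq _ _)) // size_Phi.
by rewrite coefZ Phi_coef mulr1.
Qed.

(** Subtracting the leading coefficient times a monic [Phi n] lowers the degree; by induction p is a
    combination of Phi_0, ..., Phi_(n-1), all orthogonal to Phi_m. *)
Lemma inner_lt_Phi n m p : (size p <= n)%N -> (n <= m)%N -> <(p, Phi m)> = 0.
Proof.
elim: n p => [|n IH] p.
  rewrite leqn0 size_poly_eq0 => /eqP -> _.
  by rewrite -(scale0r 0) inner_muZl mul0r.
move=> sp nm; rewrite -(subrK (p`_n *: Phi n) p) inner_muDl.
rewrite IH ?size_sub_Phi ?(ltnW nm) // inner_muZl inner_Phi (ltn_eqF nm).
by rewrite mulr0 addr0.
Qed.

Lemma inner_Phi_lt n p : (size p <= n)%N -> <(Phi n, p)> = 0.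
Proof. by move=> sp; rewrite inner_muC (@inner_lt_Phi n) // rmorph0. Qed.

(** The argument rests on the norms of the [Phi n] rather than on positivity of nu: by induction p
    is a multiple of Phi_n, and pairing with Phi_n, whose squared norm is nonzero, kills the
    coefficient. *)
Lemma inner_mu_nondegenerate n p : (size p <= n)%N ->
  (forall q, (size q <= n)%N -> <(p, q)> = 0) -> p = 0.
Proof.
elim: n p => [|n IH] p sp orth.
  by apply/eqP; rewrite -size_poly_eq0 -leqn0.
have pE : p = p`_n *: Phi n.
  apply/eqP; rewrite -subr_eq0; apply/eqP; apply: IH.
    exact: size_sub_Phi.
  move=> q sq; rewrite inner_muBl orth ?(leqW sq) // inner_muZl.
  by rewrite inner_Phi_lt // mulr0 subr0.
have := orth (Phi n); rewrite size_Phi => /(_ (leqnn _)).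
rewrite [in X in X = 0 -> _]pE inner_muZl inner_Phi eqxx => /eqP.
rewrite mulf_eq0 invr_eq0 expf_eq0 (negPf (kappa_neq0 n)) andbF orbF => /eqP p0.
by rewrite pE p0 scale0r.
Qed.

Local Notation alpha := (verblunsky Phi).
Local Notation Psi n := (revpoly n (Phi n)).

(* On the circle, [Psi n * conj (t p)] is the conjugate of
   [Phi n * conj (revpoly n.-1 p)], and that second factor has degree < n. *)
Lemma inner_Psi_XM n p : (size p <= n)%N -> <(Psi n, 'X * p)> = 0.
Proof.
case: n => [|n] sp.
  move: sp; rewrite leqn0 size_poly_eq0 => /eqP ->.
  by rewrite inner_muC mulr0 -(scale0r 0) inner_muZl mul0r rmorph0.
rewrite -[RHS](@inner_lt_Phi n.+1 n.+1 (revpoly n p)) ?size_revpoly //.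
apply: eq_int_mu => t t1.
rewrite !horner_revpoly_circle ?size_Phi // hornerM hornerX rmorphM exprSr.
have tt : t * t^* = 1 by rewrite -normCK t1 expr1n.
by rewrite -[RHS]mulr1 -tt; ring.
Qed.

Lemma Psi_coef0 n : (Psi n).[0] = 1.
Proof. by rewrite horner_coef0 coef_poly /= subn0 Phi_coef rmorph1. Qed.

(** The difference p of the two sides has degree at most n because the leading terms cancel, and it
    vanishes at 0 by the choice of alpha_n. Hence p = z q with deg q < n. Each of its three terms is
    orthogonal to z r whenever deg r < n, and multiplication by z is isometric, so q is orthogonal
    to every such r and vanishes. *)
Lemma Szego_recurrence n :
  Phi n.+1 = 'X * Phi n - (alpha n)^* *: Psi n.
Proof.
have conj_alpha : (alpha n)^* = - (Phi n.+1).[0] by rewrite /verblunsky rmorphN /= conjCK.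
apply/eqP; rewrite -subr_eq0; set p := Phi n.+1 - _.
have sXPhi : (size ('X * Phi n)%R <= n.+2)%N.
  by rewrite (leq_trans (size_polyMleq _ _)) // size_polyX size_Phi.
have sp : (size p <= n.+1)%N.
  apply: size_sub_monic; first by rewrite size_Phi.
    rewrite (leq_trans (size_polyD _ _)) // geq_max sXPhi size_polyN.
    by rewrite (leq_trans (size_scale_leq _ _)) // (leq_trans (size_revpoly _ _)).
  rewrite Phi_coef coefB coefXM Phi_coef coefZ nth_default ?size_revpoly //.
  by rewrite mulr0 subr0.
have /factor_theorem[q pE] : root p 0.
  rewrite /root /p hornerD hornerN hornerD hornerN hornerM hornerX hornerZ.
  by rewrite Psi_coef0 conj_alpha; apply/eqP; ring.
rewrite subr0 mulrC in pE.
have sq : (size q <= n)%N.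
  have [->|q0] := eqVneq q 0; first by rewrite size_poly0.
  by move: sp; rewrite pE mulrC size_mulX.
rewrite pE (@inner_mu_nondegenerate n q) ?mulr0 // => r sr.
rewrite -inner_muX -pE /p inner_muBl inner_muBl inner_muZl inner_Psi_XM //.
rewrite inner_muX !inner_Phi_lt ?mulr0 ?subr0 //.
have [->|r0] := eqVneq r 0; first by rewrite mulr0 size_poly0.
by rewrite mulrC size_mulX.
Qed.

Lemma Phistar_horner n z : z != 0 -> Phistar Phi n z = (Psi n).[z].
Proof. by move=> z0; rewrite horner_revpoly ?size_Phi. Qed.

(** This is the previous recurrence after the substitution of 1/conj(z) for z, conjugation, and
    multiplication by z^(n+1). *)
Lemma Szego_recurrence_rev n : Psi n.+1 = Psi n - alpha n *: ('X * Phi n).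
Proof.
apply: poly_ext_neq0 => z z0.
rewrite horner_revpoly ?size_Phi // Szego_recurrence hornerD hornerN hornerZ.
rewrite hornerM hornerX hornerD hornerN hornerZ hornerM hornerX.
rewrite !horner_revpoly ?size_Phi //; last by rewrite invr_eq0 conjC_eq0.
rewrite !(rmorphB, rmorphM, rmorphXn, fmorphV) /= !(conjCK, invrK).
have zn0 : z ^+ n != 0 by rewrite expf_neq0.
rewrite exprS exprVn; move: zn0; move: (z ^+ n) => zn zn0; field; by rewrite zn0.
Qed.

(** Pythagoras in z Phi_n = Phi_(n+1) + conj(alpha_n) Psi_n: the summands are orthogonal by degree,
    while z Phi_n and Psi_n both have the norm of Phi_n. *)
Lemma verblunsky_norm n :
  1 - alpha n * (alpha n)^* = ofR (kappa n) ^+ 2 / ofR (kappa n.+1) ^+ 2.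
Proof.
have k1 := kappa_neq0 n; have k2 := kappa_neq0 n.+1.
have /(congr1 (fun p => <(p, p)>)) : 'X * Phi n = Phi n.+1 + (alpha n)^* *: Psi n.
  by rewrite Szego_recurrence subrK.
rewrite inner_muX inner_Phi eqxx inner_muDl !inner_muDr inner_Phi eqxx.
rewrite !inner_muZl !inner_muZr inner_Phi_lt ?size_revpoly // inner_muC.
rewrite inner_Phi_lt ?size_revpoly // inner_mu_rev ?size_Phi // inner_Phi eqxx.
rewrite conjCK rmorph0 !mulr0 addr0 add0r.
move=> /(congr1 (fun x => x * ofR (kappa n) ^+ 2)).
rewrite mulVf ?expf_neq0 // mulrDl -!mulrA mulVf ?expf_neq0 // mulr1 => ->.
by ring.
Qed.

End Szego.

(** * Cauchy transforms off the circle *)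

Section CauchyTransform.
Local Open Scope classical_set_scope.
Local Open Scope ring_scope.
Variables (R : realType) (nu : cplx R -> R).
Hypothesis inu :
  lebesgue_measure.-integrable (@arcT R) (EFin \o (fun x : R => nu (expi x))).
Implicit Types (f g : cplx R -> cplx R) (z : cplx R) (m : nat).

(** Since dt = i t dx absorbs one power of t, the exponent m here corresponds to t^(m+1) under
    [cauchyT]; the factor 1/(2 pi) is left out. *)
Definition cauchy_mu m f z := int_mu nu (fun t => f t / t ^+ m / (t - z)).

Lemma eq_cauchy_mu m f g z : (forall t, `|t| = 1 -> f t = g t) ->
  cauchy_mu m f z = cauchy_mu m g z.
Proof. by move=> fg; apply: eq_int_mu => t t1; rewrite fg. Qed.

Lemma expi_off_circle z x : `|z| != 1 -> expi x - z != 0.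
Proof. by apply: contraNneq => /subr0_eq <-; rewrite norm_expi. Qed.

Lemma circle_continuous_kernel m f z : `|z| != 1 -> circle_continuous f ->
  circle_continuous (fun t => f t / t ^+ m / (t - z)).
Proof.
move=> z1 fc; apply: circle_continuousM.
  apply: circle_continuousM => //; apply: circle_continuousV.
    by move=> x; rewrite expf_neq0 // expi_neq0.
  exact/circle_continuousX/circle_continuous_id.
apply: circle_continuousV; first by move=> x; exact: expi_off_circle.
exact: circle_continuousB (circle_continuous_id R) (circle_continuous_cst _).
Qed.

Lemma circle_continuous_divX m f : circle_continuous f ->
  circle_continuous (fun t => f t / t ^+ m).
Proof.
move=> fc; apply: circle_continuousM => //; apply: circle_continuousV.
  by move=> x; rewrite expf_neq0 // expi_neq0.
exact/circle_continuousX/circle_continuous_id.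
Qed.

Lemma cauchyT_cauchy_mu m f z : `|z| != 1 -> circle_continuous f ->
  cauchyT (fun t => f t * (ofR (nu t) / t ^+ m.+1)) z =
  (2 * ofR pi)^-1 * cauchy_mu m f z.
Proof.
move=> z1 fc; rewrite /cauchyT invfM -mulrA; congr (_ * _).
rewrite -[RHS](mulKf (iC_neq0 R)) -(int_muZ inu); last exact: circle_continuous_kernel.
rewrite int_mu_cintegral; congr (_ * cintegral _); apply/funext => x.
have e0 := expi_neq0 x; have ez := expi_off_circle x z1.
have en : expi x ^+ m != 0 by rewrite expf_neq0.
rewrite exprS; move: en; move: (_ ^+ m) => u u0.
by field; rewrite u0 e0 ez.
Qed.

Lemma cauchy_muD m f g z : `|z| != 1 -> circle_continuous f -> circle_continuous g ->
  cauchy_mu m (fun t => f t + g t) z = cauchy_mu m f z + cauchy_mu m g z.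
Proof.
move=> z1 fc gc; rewrite -int_muD //; try exact: circle_continuous_kernel.
by apply: eq_int_mu => t _; rewrite !mulrDl.
Qed.

Lemma cauchy_muZ m c f z : `|z| != 1 -> circle_continuous f ->
  cauchy_mu m (fun t => c * f t) z = c * cauchy_mu m f z.
Proof.
move=> z1 fc; rewrite -int_muZ //; try exact: circle_continuous_kernel.
by apply: eq_int_mu => t _; rewrite !mulrA.
Qed.

Lemma circle_subr_neq0 z t : `|z| != 1 -> `|t| = 1 -> t - z != 0.
Proof. by move=> z1 t1; apply: contraNneq z1 => /subr0_eq <-; rewrite t1. Qed.

(** In z/(t - z) = t/(t - z) - 1 the factor t lowers the power in the denominator, and the constant
    leaves a moment of f. *)
Lemma cauchy_mu_shift m f z : `|z| != 1 -> circle_continuous f ->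
  z * cauchy_mu m.+1 f z = cauchy_mu m f z - int_mu nu (fun t => f t / t ^+ m.+1).
Proof.
move=> z1 fc; have kc := circle_continuous_kernel _ z1 fc.
rewrite -(int_muZ inu); last exact: kc.
rewrite -(int_muB inu); [|exact: kc|exact: (circle_continuous_divX m.+1 fc)].
apply: eq_int_mu => t t1; have t0 := circle_neq0 t1.
have tz := circle_subr_neq0 z1 t1; have tm : t ^+ m != 0 by rewrite expf_neq0.
rewrite exprS; move: tm; move: (t ^+ m) => u u0.
by field; rewrite u0 t0 tz.
Qed.

Lemma cauchy_mu_mulX m f z : `|z| != 1 -> circle_continuous f ->
  cauchy_mu m (fun t => t * f t) z =
  z * cauchy_mu m f z + int_mu nu (fun t => f t / t ^+ m).
Proof.
move=> z1 fc; rewrite -int_muZ //; try exact: circle_continuous_kernel.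
rewrite -int_muD //.
- apply: eq_int_mu => t t1; have t0 := circle_neq0 t1.
  have tz := circle_subr_neq0 z1 t1; have tm : t ^+ m != 0 by rewrite expf_neq0.
  by field; rewrite ?tm ?tz.
- apply: circle_continuousM (circle_continuous_cst _) _.
  exact: circle_continuous_kernel.
- exact: circle_continuous_divX.
Qed.

(** Differentiation under the integral by a direct estimate: the expected derivative minus the
    difference quotient equals -h times an integral that stays bounded for small h. *)
Lemma cauchy_mu_derivable m f z : `|z| != 1 -> circle_continuous f ->
  derivable (cauchy_mu m f) z 1.
Proof.
move=> z1 fc; pose g t := f t / t ^+ m.
have gc : circle_continuous g by exact: circle_continuous_divX.
have [B B0 gB] := circle_continuous_bounded gc.
have [N N0 muN] := int_mu_bound inu.
have [d d0 dz] : exists2 d : R, 0 < d & forall t, `|t| = 1 -> ofR d <= `|t - z|.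
  pose x : cplx R := `|z| - 1.
  (* This is ||z| - 1|, the distance from z to the circle, as an element of [R]; the norm itself is
     valued in [cplx R]. *)
  exists (Num.sqrt (complex.Re x ^+ 2 + complex.Im x ^+ 2)).
    by rewrite -ltcR -normc_def normr_gt0 subr_eq0.
  move=> t t1; rewrite /ofR -normc_def /x -t1 distrC; exact: ler_dist_dist.
apply/cvg_ex; exists (int_mu nu (fun t => g t / (t - z) / (t - z))).
pose k h t := g t / (t - z) ^+ 2 / (t - z - h).
have kernelc h : `|z + h| != 1 -> circle_continuous (fun t => (t - (z + h))^-1).
  move=> zh; apply: circle_continuousV; first by move=> x; exact: expi_off_circle.
  exact: circle_continuousB (circle_continuous_id R) (circle_continuous_cst _).
have kc0 : circle_continuous (fun t => (t - z)^-1).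
  by have := kernelc 0; rewrite addr0; apply.
(* The cubic kernel has two factors with |t - z| >= d and one with |t - (z + h)| >= d/2, the latter
   as soon as |h| < d/2. *)
pose K := B / d ^+ 2 / (d / 2) * N.
have dC0 : 0 < ofR d by rewrite ltcR.
have farh h t : `|h| < ofR (d / 2) -> `|t| = 1 -> ofR (d / 2) <= `|t - (z + h)|.
  move=> hd t1; rewrite opprD addrA; apply: le_trans (lerB_dist _ _).
  rewrite lerBrDr; apply: le_trans (dz _ t1).
  have -> : ofR d = ofR (d / 2) + ofR (d / 2) by rewrite -rmorphD /= -splitr.
  by rewrite lerD2l ltW.
have offh h : `|h| < ofR (d / 2) -> `|z + h| != 1.
  move=> hd; apply/eqP => zh; have := farh h _ hd zh.
  by rewrite subrr normr0 lecR leNgt divr_gt0.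
have diff h : h != 0 -> `|h| < ofR (d / 2) ->
    int_mu nu (fun t => g t / (t - z) / (t - z)) -
    h^-1 * (cauchy_mu m f (z + h) - cauchy_mu m f z) =
    - h * int_mu nu (fun t => g t * (t - z)^-1 * (t - z)^-1 * (t - (z + h))^-1).
  move=> h0 hd; have zh := offh h hd.
  have c1 := circle_continuousM gc kc0; have c2 := circle_continuousM c1 kc0.
  have c3 := circle_continuousM c2 (kernelc _ zh).
  have c4 := circle_continuousM gc (kernelc _ zh).
  rewrite -int_muB // -int_muZ //; try exact: circle_continuousB.
  rewrite -int_muB //; last 1 first.
    by apply: circle_continuousM (circle_continuous_cst _) _; exact: circle_continuousB.
  rewrite -int_muZ //; apply: eq_int_mu => t t1.
  have tz := circle_subr_neq0 z1 t1; have tzh := circle_subr_neq0 zh t1.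
  by rewrite -/(g t); field; rewrite h0 tz tzh.
have bound h : `|h| < ofR (d / 2) -> `|int_mu nu
    (fun t => g t * (t - z)^-1 * (t - z)^-1 * (t - (z + h))^-1)| <= ofR K.
  move=> hd; have zh := offh h hd.
  have c1 := circle_continuousM gc kc0; have c2 := circle_continuousM c1 kc0.
  apply: muN; first exact: circle_continuousM c2 (kernelc _ zh).
  move=> x xT; have e1 := norm_expi x.
  rewrite !normrM !normfV.
  have -> : ofR (B / d ^+ 2 / (d / 2)) = ofR B / ofR d / ofR d / ofR (d / 2).
    by rewrite -!(ofRV, ofRM) expr2 invfM mulrA.
  have dd : 0 < d / 2 by rewrite divr_gt0.
  have inv_le (a b : cplx R) : 0 < a -> a <= b -> b^-1 <= a^-1.
    by move=> a0 ab; rewrite lef_pV2 ?posrE // (lt_le_trans a0).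
  have dx : `|expi x - z|^-1 <= (ofR d)^-1 by apply: inv_le => //; exact: dz.
  have dxh : `|expi x - (z + h)|^-1 <= (ofR (d / 2))^-1.
    by apply: inv_le; [rewrite ltcR|exact: farh].
  have dg := gB x xT; rewrite normrM normfV in dg.
  by do 3!(apply: ler_pM; rewrite ?mulr_ge0 ?invr_ge0 ?normr_ge0 //).
have K0 : 0 <= K by rewrite !mulr_ge0 ?invr_ge0 ?sqr_ge0 ?divr_ge0 // ltW.
have K1 : 0 < ofR K + 1 by rewrite ltr_wpDl // lecR.
apply: (iffRL (@cvgrPdist_le (cplx R) (cplx R : numFieldType) _ _ _ _ _)) => eps eps0; near=> h.
have h0 : h != 0 by near: h; exact: nbhs_dnbhs_neq.
have hd : `|h| < ofR (d / 2).
  by near: h; apply: dnbhs0_lt; rewrite ltcR divr_gt0.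
(* One is added because [K] is only known to be nonnegative. *)
have he : `|h| < eps / (ofR K + 1).
  by near: h; apply: dnbhs0_lt; rewrite divr_gt0.
rewrite /= -[h *: 1]/(h * 1) mulr1 (addrC h) -[_ *: _]/(_ * _) diff // normrM normrN.
have : `|h| * (ofR K + 1) <= eps by rewrite -ler_pdivlMr // ltW.
apply: le_trans; apply: ler_pM => //; rewrite (le_trans (bound _ hd)) //.
by rewrite lerDl.
Unshelve. all: by end_near.
Qed.

End CauchyTransform.

(** * Two by two matrices and their entrywise derivatives *)

Section Matrix2.
Local Open Scope classical_set_scope.
Local Open Scope ring_scope.
Variable R : realType.
Implicit Types (a b c d z : cplx R) (F G : cplx R -> 'M[cplx R]_2).

Lemma forall_ord2 (P : 'I_2 -> Prop) : P 0 -> P 1 -> forall i, P i.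
Proof.
move=> P0 P1 [[|[|i]] hi] //; first by move: P0; congr P; exact/val_inj.
by move: P1; congr P; exact/val_inj.
Qed.

Lemma mx2P (M N : 'M[cplx R]_2) : M 0 0 = N 0 0 -> M 0 1 = N 0 1 ->
  M 1 0 = N 1 0 -> M 1 1 = N 1 1 -> M = N.
Proof.
by move=> *; apply/matrixP; apply: forall_ord2 => //; apply: forall_ord2.
Qed.

Lemma mx2M a b c d a' b' c' d' : mx2 a b c d *m mx2 a' b' c' d' =
  mx2 (a * a' + b * c') (a * b' + b * d') (c * a' + d * c') (c * b' + d * d').
Proof.
by apply: mx2P; rewrite !mxE !big_ord_recl big_ord0 !mxE /= addr0.
Qed.

Lemma mx2Z k a b c d : k *: mx2 a b c d = mx2 (k * a) (k * b) (k * c) (k * d).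
Proof. by apply: mx2P; rewrite !mxE. Qed.

Lemma mx2D a b c d a' b' c' d' : mx2 a b c d + mx2 a' b' c' d' =
  mx2 (a + a') (b + b') (c + c') (d + d').
Proof. by apply: mx2P; rewrite !mxE. Qed.

Lemma mx2_unit a b c d : a * d - b * c != 0 -> mx2 a b c d \in unitmx.
Proof.
move=> D0; have [] // : mx2 a b c d \in unitmx /\
    (a * d - b * c)^-1 *: mx2 d (- b) (- c) a \in unitmx.
apply: mulmx1_unit; rewrite mx2Z mx2M.
by apply: mx2P; rewrite !mxE /=; field.
Qed.

Definition mxderivable F z := forall i j, derivable (fun u => F u i j : cplx R) z 1.

Lemma mxderivable_mx2 (f g h k : cplx R -> cplx R) z :
  derivable f z 1 -> derivable g z 1 -> derivable h z 1 -> derivable k z 1 ->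
  mxderivable (fun u => mx2 (f u) (g u) (h u) (k u)) z.
Proof.
have eq_d (e1 e2 : cplx R -> cplx R) : e1 =1 e2 -> derivable e2 z 1 -> derivable e1 z 1.
  by move=> /funext ->.
move=> df dg dh dk; apply: forall_ord2; apply: forall_ord2.
- by apply: (eq_d _ f) => // u; rewrite mxE.
- by apply: (eq_d _ g) => // u; rewrite mxE.
- by apply: (eq_d _ h) => // u; rewrite mxE.
- by apply: (eq_d _ k) => // u; rewrite mxE.
Qed.

Lemma mxderive1_mx2 (f g h k : cplx R -> cplx R) z :
  mxderive1 (fun u => mx2 (f u) (g u) (h u) (k u)) z =
  mx2 (derive1 f z) (derive1 g z) (derive1 h z) (derive1 k z).
Proof.
have eq_d (e1 e2 : cplx R -> cplx R) : e1 =1 e2 -> derive1 e1 z = derive1 e2 z.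
  by move=> /funext ->.
by apply: mx2P; rewrite !mxE /=; apply: eq_d => u; rewrite mxE.
Qed.

Lemma mxderive1E F z i j : mxderive1 F z i j = 'D_1 (fun u => F u i j : cplx R) z.
Proof. by rewrite mxE derive1E. Qed.

Lemma mxderive1M F G z : mxderivable F z -> mxderivable G z ->
  mxderive1 (fun u => F u *m G u) z = mxderive1 F z *m G z + F z *m mxderive1 G z.
Proof.
move=> dF dG; have := mxderive1E G z; have := mxderive1E F z.
move: (mxderive1 F z) (mxderive1 G z) => F' G' F'E G'E.
apply/matrixP => i j; rewrite mxderive1E 3!mxE -big_split /=.
have -> : (fun u => (F u *m G u) i j) =
    \sum_k ((fun u => F u i k) * (fun u => G u k j)).
  by apply/funext => u; rewrite mxE fct_sumE.
rewrite derive_sum => [|k]; last exact: derivableM (dF i k) (dG k j).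
apply: eq_bigr => k _; rewrite (deriveM (dF i k) (dG k j)) F'E G'E addrC.
by congr (_ + _); rewrite -[_ *: _]/(_ * _) mulrC.
Qed.

Lemma near_eq_mxderive1 F G z : (\near z, F z = G z) -> mxderive1 F z = mxderive1 G z.
Proof.
move=> FG; apply/matrixP => i j; apply: etrans (mxderive1E F z i j) _.
apply: etrans (esym (mxderive1E G z i j)); apply: near_eq_derive.
by apply: filterS FG => u ->.
Qed.

Lemma derive1_is (f : cplx R -> cplx R) z (d : cplx R) :
  is_derive z (1 : cplx R) f d -> derive1 f z = d.
Proof. by move=> fd; rewrite derive1E derive_val. Qed.

End Matrix2.

(** * Recurrence, invertibility and differentiability of [Ymx] *)

Section FundamentalMatrix.
Local Open Scope classical_set_scope.
Local Open Scope ring_scope.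
Variables (R : realType) (nu : cplx R -> R).
Variables (Phi : nat -> {poly cplx R}) (kappa : nat -> R).
Hypothesis hnu : weightT nu.
Hypothesis hPhi : is_MOPUC nu Phi kappa.
Implicit Types z u : cplx R.

Let inu := hnu.1.
Local Notation alpha := (verblunsky Phi).
Local Notation b := (bcoef kappa).
Local Notation Psi n := (revpoly n (Phi n)).
Local Notation W m p := (cauchy_mu nu m (horner p)).

Lemma horner_is_derivable (p : {poly cplx R}) z : derivable (horner p) z 1.
Proof.
elim/poly_ind: p => [|p c IH].
  rewrite (_ : horner 0 = cst 0); first exact: derivable_cst.
  by apply/funext => u; rewrite horner0.
pose f : cplx R -> cplx R := horner p; pose g : cplx R -> cplx R := id.
have df : derivable f z 1 by exact: IH.
have dg : derivable g z 1 by exact: derivable_id.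
have dfg : derivable (f * g + cst c) z 1.
  apply: derivableD; last exact: derivable_cst.
  exact: derivableM df dg.
suff -> : horner (p * 'X + c%:P) = f * g + cst c by exact: dfg.
by apply/funext => u; rewrite !hornerE.
Qed.

Lemma eq_cauchyT f g z : (forall t, `|t| = 1 -> f t = g t) ->
  cauchyT f z = cauchyT g z.
Proof.
move=> fg; congr (_ * cintegral _); apply/funext => x.
by rewrite fg // norm_expi.
Qed.

(** In [Ymx] at n+1 both entries of the second column carry t^(n+1), so both become transforms with
    the same exponent n. *)
Lemma Gfun_cauchy_mu n z : `|z| != 1 ->
  Gfun nu Phi n.+1 z = (2 * ofR pi)^-1 * W n (Phi n.+1) z.
Proof. by move=> z1; apply: cauchyT_cauchy_mu => //; exact: circle_continuous_horner. Qed.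

Lemma Gstar_cauchy_mu n z : `|z| != 1 ->
  Gstar nu Phi n z = (2 * ofR pi)^-1 * W n (Psi n) z.
Proof.
move=> z1; rewrite -cauchyT_cauchy_mu //; last exact: circle_continuous_horner.
by apply: eq_cauchyT => t t1; rewrite (Phistar_horner hPhi) // circle_neq0.
Qed.

Lemma cauchy_mu_hornerD m (p q : {poly cplx R}) z : `|z| != 1 ->
  W m (p + q) z = W m p z + W m q z.
Proof.
move=> z1; rewrite -cauchy_muD //; try exact: circle_continuous_horner.
by apply: eq_cauchy_mu => t _; rewrite hornerD.
Qed.

Lemma cauchy_mu_hornerZ m c (p : {poly cplx R}) z : `|z| != 1 ->
  W m (c *: p) z = c * W m p z.
Proof.
move=> z1; rewrite -cauchy_muZ //; last exact: circle_continuous_horner.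
by apply: eq_cauchy_mu => t _; rewrite hornerZ.
Qed.

(** As 1/t = conj(t) on the circle, the moments left over by the shift are inner products, hence
    accessible to orthogonality. *)
Lemma int_mu_divX (p : {poly cplx R}) m :
  int_mu nu (fun t => p.[t] / t ^+ m) = inner_mu nu p 'X^m.
Proof.
apply: eq_int_mu => t t1; rewrite hornerXn rmorphXn /= -exprVn.
by congr (_ * _ ^+ m); rewrite invC_norm t1 expr1n invr1 mul1r.
Qed.

Lemma cauchy_mu_hornerMX m (p : {poly cplx R}) z : `|z| != 1 ->
  W m ('X * p) z = z * W m p z + inner_mu nu p 'X^m.
Proof.
move=> z1; rewrite -int_mu_divX -cauchy_mu_mulX //; last exact: circle_continuous_horner.
by apply: eq_cauchy_mu => t _; rewrite hornerM hornerX.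
Qed.

Lemma cauchy_mu_horner_shift m (p : {poly cplx R}) z : `|z| != 1 ->
  z * W m.+1 p z = W m p z - inner_mu nu p 'X^(m.+1).
Proof.
by move=> z1; rewrite -int_mu_divX cauchy_mu_shift //; exact: circle_continuous_horner.
Qed.

Lemma bcoef_neq0 n : b n != 0.
Proof.
case: hPhi => _ /(_ n) k0 _; apply/eqP => /complexI /eqP.
by rewrite !mulf_eq0 pnatr_eq0 /= !(gt_eqF k0) (gt_eqF (pi_gt0 R)).
Qed.

Lemma bcoefE n : b n = 2 * ofR pi * ofR (kappa n) ^+ 2.
Proof. by rewrite /bcoef !ofRM expr2; congr (_ * _ * _); exact: rmorph_nat. Qed.

Lemma bcoef_ratio n : b n = (1 - alpha n * (alpha n)^*) * b n.+1.
Proof.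
rewrite (verblunsky_norm hnu hPhi) !bcoefE.
by move: (ofR (kappa _)) (kappa_neq0 hPhi n.+1) => k k0; field.
Qed.

(** Eliminating z Phi_n between the two Szego recurrences leaves only Phi_(n+1) and Psi_n, which up
    to constants form the first column of Y_(n+1); the coefficient 1 - |alpha_n|^2 is
    b_n/b_(n+1). *)
Lemma Psi_three_term n :
  Psi n.+1 = (b n / b n.+1) *: Psi n - alpha n *: Phi n.+1.
Proof.
have -> : b n / b n.+1 = 1 - alpha n * (alpha n)^*.
  by rewrite bcoef_ratio mulfK // bcoef_neq0.
rewrite (Szego_recurrence_rev hnu hPhi) (Szego_recurrence hnu hPhi).
apply: poly_ext_neq0 => z _.
by rewrite !(hornerD, hornerN, hornerZ, hornerM, hornerX); ring.
Qed.

Lemma Phi_three_term n :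
  Phi n.+2 = ('X * Phi n.+1 + ((alpha n.+1)^* * alpha n) *: Phi n.+1) -
             ((alpha n.+1)^* * (b n / b n.+1)) *: Psi n.
Proof.
rewrite (Szego_recurrence hnu hPhi) Psi_three_term scalerBr !scalerA opprB.
by rewrite addrA.
Qed.

Lemma inner_Psi_X n : inner_mu nu (Psi n.+1) 'X^(n.+1) = 0.
Proof.
by rewrite exprS (inner_Psi_XM hnu hPhi) // size_polyXn.
Qed.

Lemma Ymx_recurrence n z : z != 0 -> `|z| != 1 ->
  Ymx nu Phi kappa n.+2 z *m mx2 1 0 0 z =
  Tmx Phi kappa n.+1 z *m Ymx nu Phi kappa n.+1 z.
Proof.
move=> z0 z1; have b1 := bcoef_neq0 n.+1; have b0 := bcoef_neq0 n.
have pi0 : ofR pi != 0 :> cplx R.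
  by apply/eqP => /complexI /eqP; rewrite gt_eqF ?pi_gt0.
(* The moment produced by the shift is the inner product of Psi_(n+1) with z^(n+1), which vanishes,
   so the three-term relation passes to the transforms. *)
have PsiW : z * W n.+1 (Psi n.+1) z = b n / b n.+1 * W n (Psi n) z -
    alpha n * W n (Phi n.+1) z.
  rewrite cauchy_mu_horner_shift // inner_Psi_X subr0 Psi_three_term.
  by rewrite -scaleNr cauchy_mu_hornerD // !cauchy_mu_hornerZ // mulNr.
(* Two moments appear: Phi_(n+2) against z^(n+1) from the shift, and Phi_(n+1) against z^n from the
   product by z. Both vanish by degree. *)
have PhiW : z * W n.+1 (Phi n.+2) z = (z + (alpha n.+1)^* * alpha n) *
    W n (Phi n.+1) z - (alpha n.+1)^* * (b n / b n.+1) * W n (Psi n) z.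
  rewrite cauchy_mu_horner_shift // (inner_Phi_lt hnu hPhi) ?size_polyXn // subr0.
  rewrite Phi_three_term -scaleNr !cauchy_mu_hornerD // !cauchy_mu_hornerZ //.
  rewrite cauchy_mu_hornerMX // (inner_Phi_lt hnu hPhi) ?size_polyXn //.
  by rewrite addr0 mulrDl mulNr.
have PsiZ : (Psi n.+1).[z] = b n / b n.+1 * (Psi n).[z] - alpha n * (Phi n.+1).[z].
  by rewrite Psi_three_term hornerD hornerN !hornerZ.
have PhiZ : (Phi n.+2).[z] = (z + (alpha n.+1)^* * alpha n) * (Phi n.+1).[z] -
    (alpha n.+1)^* * (b n / b n.+1) * (Psi n).[z].
  rewrite Phi_three_term !(hornerD, hornerN, hornerZ, hornerM, hornerX).
  by rewrite mulrDl.
rewrite /Ymx /Tmx /= !mx2M !mulr0 !addr0 !add0r !mulr1 !mul1r.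
rewrite !(Phistar_horner hPhi) // !Gfun_cauchy_mu // !Gstar_cauchy_mu //.
rewrite PsiZ PhiZ; move: PsiW PhiW; clear PsiZ PhiZ.
move: (W n.+1 (Phi n.+2) z) (W n.+1 (Psi n.+1) z) (W n (Phi n.+1) z) (W n (Psi n) z).
move: (alpha n) (alpha n.+1)^* (b n) (b n.+1) (ofR pi) b0 b1 pi0.
move=> a0 a1 c0 c1 p c00 c10 p0 WPhi' WPsi' WPhi WPsi PsiW PhiW; congr mx2.
- by field.
- transitivity ((2 * p)^-1 * (z * WPhi')); first by field.
  by rewrite PhiW; field; rewrite p0.
- by field.
- transitivity (- c1 * (2 * p)^-1 * (z * WPsi')); first by field.
  by rewrite PsiW; field; rewrite p0.
Qed.

Lemma det_Tmx n z :
  (z + (alpha n.+1)^* * alpha n) * 1 - (alpha n.+1)^* / b n.+1 * (alpha n * b n.+1) = z.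
Proof. by move: (b _) (bcoef_neq0 n.+1) => c c0; field. Qed.

Lemma Phi0E : Phi 0 = 1.
Proof.
have := size_Phi hPhi 0; have := Phi_coef hPhi 0.
move=> Phi00 /eqP/size_poly1P[c _ PhiE].
by move: Phi00; rewrite PhiE coefC /= => ->.
Qed.

Lemma Psi0E : Psi 0 = 1.
Proof.
apply: poly_ext_neq0 => z z0.
by rewrite horner_revpoly ?Phi0E ?size_poly1 // !hornerC rmorph1 mulr1.
Qed.

(** The transform of Phi_1 is Phi_1(z) times that of 1, plus kappa_0^(-2). The products of Phi_1(z)
    with the transform of 1 cancel in the determinant, and the remainder is b_0 kappa_0^(-2) / (2
    pi) = 1. *)
Lemma Ymx1_det z : `|z| != 1 -> z != 0 ->
  (Phi 1).[z] * (- b 0 * Gstar nu Phi 0 z) -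
  Gfun nu Phi 1 z * (- b 0 * Phistar Phi 0 z) = 1.
Proof.
move=> z1 z0; rewrite (Phistar_horner hPhi) // Gfun_cauchy_mu // Gstar_cauchy_mu //.
have PhiW : W 0 (Phi 1) z = (z - (alpha 0)^*) * W 0 (Psi 0) z + ofR (kappa 0) ^- 2.
  rewrite (Szego_recurrence hnu hPhi) -scaleNr cauchy_mu_hornerD //.
  have i0 : inner_mu nu (Phi 0) 'X^0 = ofR (kappa 0) ^- 2.
    by rewrite expr0 -[X in inner_mu _ _ X]Phi0E (inner_Phi hPhi) eqxx.
  by rewrite cauchy_mu_hornerZ // cauchy_mu_hornerMX // i0 Psi0E Phi0E; ring.
rewrite PhiW (Szego_recurrence hnu hPhi) hornerD hornerN hornerZ hornerM hornerX.
rewrite Psi0E Phi0E bcoefE hornerC.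
have pi0 : ofR pi != 0 :> cplx R.
  by apply/eqP => /complexI /eqP; rewrite gt_eqF ?pi_gt0.
move: (ofR pi) pi0 (ofR (kappa 0)) (kappa_neq0 hPhi 0) (W 0 1 z) (alpha 0)^*.
by move=> p p0 k k0 w a; field; rewrite p0 k0.
Qed.

Lemma Ymx_unit n z : z != 0 -> `|z| != 1 -> Ymx nu Phi kappa n.+1 z \in unitmx.
Proof.
move=> z0 z1; elim: n => [|n IH].
  by apply: mx2_unit; rewrite Ymx1_det // oner_neq0.
(* Invertibility alone is carried through the induction: Y_(n+2) is a left factor of this invertible
   product. *)
have : Tmx Phi kappa n.+1 z *m Ymx nu Phi kappa n.+1 z \in unitmx.
  by rewrite unitmx_mul IH andbT; apply: mx2_unit; rewrite det_Tmx.
by rewrite -(Ymx_recurrence n z0 z1) unitmx_mul => /andP[].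
Qed.

Lemma near_off_circle z : `|z| != 1 -> \forall u \near z, `|u| != 1.
Proof.
rewrite -subr_eq0 -normr_gt0 => /(nbhsx_ballx z); apply: filterS => u.
rewrite -ball_normE /= => zu; apply: contraTneq zu => u1.
by rewrite -u1 le_gtF // ler_dist_dist.
Qed.

Lemma near_neq0 z : z != 0 -> \forall u \near z, u != 0.
Proof.
rewrite -normr_gt0 => /(nbhsx_ballx z); apply: filterS => u.
by rewrite -ball_normE /=; apply: contraTneq => ->; rewrite subr0 ltxx.
Qed.

Lemma Ymx_derivable n z : z != 0 -> `|z| != 1 -> mxderivable (Ymx nu Phi kappa n.+1) z.
Proof.
move=> z0 z1; have dZ (c : cplx R) (f : cplx R -> cplx R) : derivable f z 1 ->
    derivable (fun u => c * f u) z 1.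
  by move=> df; exact: derivableM (derivable_cst c z 1) df.
have dW m (p : {poly cplx R}) : derivable (W m p) z 1.
  by apply: cauchy_mu_derivable => //; exact: circle_continuous_horner.
(* The expressions through [W] and [revpoly] are valid only off 0 and off the circle, but this holds
   on a neighbourhood of z, which suffices for a derivative. *)
have near_d (f g : cplx R -> cplx R) : (forall u, u != 0 -> `|u| != 1 -> f u = g u) ->
    derivable f z 1 -> derivable g z 1.
  move=> fg; apply: near_eq_derivable.
  apply: filterS2 (near_off_circle z1) (near_neq0 z0) => u u1 u0; exact: fg.
apply: mxderivable_mx2.
- exact: horner_is_derivable.
- apply: (near_d _ _ _ (dZ (2 * ofR pi)^-1 _ (dW n (Phi n.+1)))) => u _ u1.
  by rewrite Gfun_cauchy_mu.
- apply: (dZ _ (Phistar Phi n)).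
  apply: (near_d (horner (Psi n)) _ _ (@horner_is_derivable (Psi n) z)) => u u0 _.
  by rewrite (Phistar_horner hPhi).
- apply: (dZ _ (Gstar nu Phi n)).
  apply: (near_d _ _ _ (dZ (2 * ofR pi)^-1 _ (dW n (Psi n)))) => u _ u1.
  by rewrite Gstar_cauchy_mu.
Qed.

End FundamentalMatrix.

(** * Algebra of the logarithmic derivative and of zero curvature *)

Lemma half_power_logder (K : numFieldType) (h s h' s' z a q N p : K) :
    h != 0 -> s != 0 -> a != 0 -> p != 0 -> h ^+ 2 = z -> 2 * h * h' = 1 ->
    z * a * (2 * s * s') = q * s ^+ 2 ->
  let theta := - N / (2 * z) + q / (2 * (z * a)) in
  (h * p)^-1 * s' + s * (- (h * p) ^- 2 * (N * p * h')) = theta * ((h * p)^-1 * s)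
  /\ (h * p) * (- s ^- 2 * s') + s^-1 * (N * p * h') = - theta * (h * p / s).
Proof.
move=> h0 s0 a0 p0 <- hh' ss' theta.
have h2 : 2 * h != 0 by rewrite mulf_neq0 ?pnatr_eq0.
(* The symbols h', s', N, p stand for the derivatives of h and s, for n+1 and for h^n. The
   hypotheses determine h' = 1/(2h) and s' = q s/(2 z a), after which both claims are rational
   identities. *)
have -> : h' = (2 * h)^-1 by apply: (mulfI h2); rewrite hh' mulfV.
have k0 : h ^+ 2 * a * (2 * s) != 0 by rewrite !mulf_neq0 ?expf_neq0 ?pnatr_eq0.
have -> : s' = q * s / (2 * (h ^+ 2 * a)).
  by apply: (mulfI k0); rewrite -[LHS]mulrA ss'; field; rewrite h0 a0.
by rewrite /theta; split; field; rewrite ?h0 ?s0 ?a0 ?p0.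
Qed.

(** Derivatives enter as arbitrary matrices tied by the differentiated recurrence, with k = 1/(2z).
    After right multiplication by Y0, the right side is T' Y0 - Y1 (D' + k D S), and the hypothesis
    on D' turns this into T' Y0 - k Y1 D. *)
Lemma zero_curvature_mx (K : fieldType) (m : nat)
    (Y0 Y1 Y0' Y1' T T' D D' S M0 M1 : 'M[K]_m) (th0 th1 k : K) :
    Y0 \in unitmx -> Y1 *m D = T *m Y0 ->
    Y1' *m D + Y1 *m D' = T' *m Y0 + T *m Y0' ->
    M0 *m Y0 = Y0' + th0 *: (Y0 *m S) -> M1 *m Y1 = Y1' + th1 *: (Y1 *m S) ->
    S *m D = D *m S -> D' + k *: (D *m S) = k *: D -> th1 - th0 = - k ->
  T' - k *: T = M1 *m T - T *m M0.
Proof.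
move=> uY YT dYT eM0 eM1 DC Dz dtheta; apply: (can_inj (mulmxK uY)).
(* T Y0 is replaced by Y1 D so that M1 meets Y1; commuting S with D then gives the same matrix Y1 D
   S as in [e2], and only th1 - th0 survives. *)
have e1 : M1 *m T *m Y0 = Y1' *m D + th1 *: (Y1 *m D *m S).
  by rewrite -mulmxA -YT mulmxA eM1 mulmxDl -scalemxAl -mulmxA DC mulmxA.
have e2 : T *m M0 *m Y0 = T *m Y0' + th0 *: (Y1 *m D *m S).
  by rewrite -mulmxA eM0 mulmxDr -scalemxAr mulmxA -YT.
rewrite [RHS]mulmxBl e1 e2 opprD addrACA -scalerBl dtheta.
have -> : Y1' *m D - T *m Y0' = T' *m Y0 - Y1 *m D'.
  by apply/eqP; rewrite subr_eq addrAC eq_sym subr_eq eq_sym; apply/eqP.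
rewrite scaleNr -addrA -opprD -mulmxA scalemxAr -mulmxDr Dz.
by rewrite mulmxBl -scalemxAl -YT scalemxAr.
Qed.

(** * Structure matrices of a semiclassical weight *)

Section StructureMatrix.
Local Open Scope classical_set_scope.
Local Open Scope ring_scope.
Variables (R : realType) (nu : cplx R -> R).
Variables (A : {poly cplx R}) (q : cplx R -> cplx R).
Variables (Phi : nat -> {poly cplx R}) (kappa : nat -> R).
Hypothesis hnu : weightT nu.
Hypothesis hPhi : is_MOPUC nu Phi kappa.
Implicit Types (z u c : cplx R) (f h s : cplx R -> cplx R).

Definition pauli3 : 'M[cplx R]_2 := mx2 1 0 0 (-1).

(* C_n' C_n^{-1} = logder_C n *: pauli3. *)
Definition logder_C n z : cplx R := - n%:R / (2 * z) + q z / (2 * (z * A.[z])).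

Lemma nu_branch_pearson c r f : nu_branch nu A q c r f -> pearson_on A q c r f.
Proof. by case. Qed.

Lemma near_disc c r z : disc c r z -> \forall u \near z, disc c r u.
Proof. by move=> cz; apply: open_nbhs_nbhs; split => //; exact: ball_open. Qed.

Lemma sqrt_branch_derive1 c r f s z : sqrt_branch_on c r f s -> disc c r z ->
  2 * s z * derive1 s z = derive1 f z.
Proof.
move=> hs cz; have ds := (hs z cz).1.
have <- : derive1 (s * s) z = derive1 f z.
  rewrite !derive1E; apply: near_eq_derive; apply: filterS (near_disc cz) => u /hs[_].
  by rewrite expr2.
rewrite [RHS]derive1E (deriveM ds ds) derive1E -[_ *: _]/(_ * _).
by rewrite -mulrDl -mulr2n mulr_natl.
Qed.

(** Only the squares h^2 = z and s^2 = f and the equation satisfied by f are used, which is why the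
    factor [logder_C] does not depend on the branches. *)
Lemma Cmx_derivable c r f h s n z : pearson_on A q c r f -> disc c r z ->
  sqrt_branch_on c r id h -> sqrt_branch_on c r f s ->
  [/\ mxderivable (Cmx h s n.+1) z, Cmx h s n.+1 z \in unitmx &
    mxderive1 (Cmx h s n.+1) z = logder_C n.+1 z *: (pauli3 *m Cmx h s n.+1 z)].
Proof.
move=> [_ pear] cz hh hs; have [zA _ f0 Pf] := pear z cz.
have [dh hz] := hh z cz; have [ds sz] := hs z cz.
have h1 : 2 * h z * derive1 h z = 1.
  by rewrite (sqrt_branch_derive1 hh cz) derive1E derive_id.
have s1 := sqrt_branch_derive1 hs cz.
have A0 : A.[z] != 0 by apply/eqP => A0; apply: zA; rewrite /zerosZ /= A0 mulr0.
have hz0 : h z != 0.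
  by apply: contra_notN zA => /eqP h0; rewrite /zerosZ /= -[z]/(id z) -hz h0 expr0n mul0r.
have sz0 : s z != 0 by apply: contraNneq f0 => s0; rewrite -sz s0 expr0n.
have isD (g : cplx R -> cplx R) : derivable g z 1 -> is_derive z 1 g (derive1 g z).
  by move=> dg; exact: DeriveDef dg (esym (derive1E g z)).
have Dh := isD h dh; have Ds := isD s ds.
have DhN : is_derive z 1 (fun u => h u ^+ n.+1) (n.+1%:R * h z ^+ n * derive1 h z).
  by rewrite -exprfctE; exact: is_deriveX.
have hN0 : h z ^+ n.+1 != 0 by rewrite expf_neq0.
have isV (g : cplx R -> cplx R) (dg : cplx R) : g z != 0 -> is_derive z 1 g dg ->
    is_derive z 1 (fun u => (g u)^-1) (- (g z) ^- 2 * dg).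
  move=> g0 Dg; apply: DeriveDef; first exact: derivableV g0 (@ex_derive _ _ _ _ _ _ _ Dg).
  by rewrite (deriveV g0 (@ex_derive _ _ _ _ _ _ _ Dg)) derive_val.
have D1 := is_deriveM (isV _ _ hN0 DhN) Ds.
have D2 := is_deriveM DhN (isV _ _ sz0 Ds).
split.
- apply: mxderivable_mx2; [exact: (@ex_derive _ _ _ _ _ _ _ D1)|exact: derivable_cst|
    exact: derivable_cst|exact: (@ex_derive _ _ _ _ _ _ _ D2)].
- apply: mx2_unit; rewrite mulr0 subr0 mulrACA mulVf // mul1r.
  by rewrite mulfV // oner_neq0.
- rewrite mxderive1_mx2 (derive1_is D1) (derive1_is D2) !derive1_cst.
  rewrite /pauli3 /Cmx mx2M mx2Z /logder_C -[_ *: _]/(_ * _).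
  have p0 := expf_neq0 n hz0.
  (* Since 2 s s' = f' and s^2 = f, this is the equation z A f' = q f rewritten for the square
     root. *)
  have eq_s : z * A.[z] * (2 * s z * derive1 s z) = q z * s z ^+ 2 by rewrite s1 Pf sz.
  have [e1 e2] := half_power_logder n.+1%:R hz0 sz0 A0 p0 hz h1 eq_s.
  rewrite exprS; congr mx2; rewrite ?mul0r ?mulr0 ?addr0 ?add0r ?mul1r ?mulr0 //.
  by rewrite mulN1r mulrN -mulNr.
Qed.

(* The right-hand side no longer mentions the branches hidden in the
   structure matrix, so different n may use different ones. *)
Lemma structure_matrix_mulY n z M : ~ zerosZ A z -> `|z| != 1 ->
  is_structure_matrix nu A q Phi kappa n.+1 z M ->
  M *m Ymx nu Phi kappa n.+1 z = mxderive1 (Ymx nu Phi kappa n.+1) z +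
    logder_C n.+1 z *: (Ymx nu Phi kappa n.+1 z *m pauli3).
Proof.
move=> zA z1 [c [r [f [h [s [nuf cz hh hs ->]]]]]].
have z0 : z != 0 by apply/eqP => z0; apply: zA; rewrite /zerosZ /= z0 mul0r.
have [dC uC C'] := Cmx_derivable n (nu_branch_pearson nuf) cz hh hs.
have uY := Ymx_unit hnu hPhi n z0 z1.
have dY := Ymx_derivable hnu hPhi (n:=n) z0 z1.
rewrite mxderive1M // C' /Zmx.
move: (mxderive1 _ z) (Ymx _ _ _ _ z) (Cmx _ _ _ z) uY uC => Y' Y C uY uC.
apply: (can_inj (mulmxK uC)); rewrite -(mulmxA _ Y C) mulmxKV; last by rewrite unitmx_mul uY.
by rewrite mulmxDl -scalemxAl -scalemxAr mulmxA.
Qed.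

Lemma Tmx_mxderivable n z : mxderivable (Tmx Phi kappa n) z.
Proof.
apply: mxderivable_mx2; [|exact: derivable_cst|exact: derivable_cst|exact: derivable_cst].
by apply: derivableD; [exact: derivable_id|exact: derivable_cst].
Qed.

Lemma zero_curvature n z (M0 M1 : 'M[cplx R]_2) : ~ zerosZ A z -> `|z| != 1 ->
  is_structure_matrix nu A q Phi kappa n.+1 z M0 ->
  is_structure_matrix nu A q Phi kappa n.+2 z M1 ->
  mxderive1 (Tmx Phi kappa n.+1) z - (2 * z)^-1 *: Tmx Phi kappa n.+1 z =
  M1 *m Tmx Phi kappa n.+1 z - Tmx Phi kappa n.+1 z *m M0.
Proof.
move=> zA z1 hM0 hM1.
have z0 : z != 0 by apply/eqP => z0; apply: zA; rewrite /zerosZ /= z0 mul0r.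
have eM0 := structure_matrix_mulY zA z1 hM0.
have eM1 := structure_matrix_mulY zA z1 hM1.
have uY := Ymx_unit hnu hPhi n z0 z1.
have YT := Ymx_recurrence hnu hPhi n z0 z1.
pose D u : 'M[cplx R]_2 := mx2 1 0 0 u.
have dD : mxderivable D z.
  apply: mxderivable_mx2; [exact: derivable_cst|exact: derivable_cst|
    exact: derivable_cst|exact: derivable_id].
have D' : mxderive1 D z = mx2 0 0 0 1.
  rewrite mxderive1_mx2 !derive1_cst; congr mx2.
  by rewrite derive1E derive_id.
have dYT : mxderive1 (Ymx nu Phi kappa n.+2) z *m D z +
      Ymx nu Phi kappa n.+2 z *m mx2 0 0 0 1 =
    mxderive1 (Tmx Phi kappa n.+1) z *m Ymx nu Phi kappa n.+1 z +
      Tmx Phi kappa n.+1 z *m mxderive1 (Ymx nu Phi kappa n.+1) z.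
  rewrite -D' -(mxderive1M (Ymx_derivable hnu hPhi (n:=n.+1) z0 z1) dD).
  rewrite -(mxderive1M (@Tmx_mxderivable n.+1 z) (Ymx_derivable hnu hPhi (n:=n) z0 z1)).
  (* The recurrence holds on a neighbourhood of z, so both products have the same derivative at
     z. *)
  apply: near_eq_mxderive1.
  apply: filterS2 (near_off_circle z1) (near_neq0 z0) => u u1 u0.
  exact: Ymx_recurrence.
have dtheta : logder_C n.+2 z - logder_C n.+1 z = - (2 * z)^-1.
  rewrite /logder_C -[n.+2]addn1 natrD.
  by move: (n.+1%:R) (q z / _) => N X; field.
(* In the last diagonal entry both sides are 1/2: 1 - z/(2z) on the left and z/(2z) on the right. *)
have Dz : mx2 0 0 0 1 + (2 * z)^-1 *: (D z *m pauli3) = (2 * z)^-1 *: D z.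
  rewrite mx2M !mx2Z mx2D; congr mx2; rewrite ?mul0r ?mulr0; try ring; by field.
have DC : pauli3 *m D z = D z *m pauli3.
  by rewrite !mx2M; congr mx2; ring.
exact: zero_curvature_mx uY YT dYT eM0 eM1 DC Dz dtheta.
Qed.

End StructureMatrix.

Theorem proposition3p4 (R : realType) (nu : cplx R -> R)
    (A : {poly cplx R}) (q : cplx R -> cplx R)
    (Phi : nat -> {poly cplx R}) (kappa : nat -> R)
    (M : nat -> cplx R -> 'M[cplx R]_2)
    (hnu : weightT nu)
    (hsc : gen_semiclassical nu A q)
    (hPhi : is_MOPUC nu Phi kappa)
    (hM : forall (n : nat) (z : cplx R), (0 < n)%N ->
        `|z| <> 1 -> ~ zerosZ A z ->
        is_structure_matrix nu A q Phi kappa n z (M n z)) :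
  forall (n : nat) (z : cplx R), (0 < n)%N -> `|z| <> 1 -> ~ zerosZ A z ->
    mxderive1 (Tmx Phi kappa n) z - (2 * z)^-1 *: Tmx Phi kappa n z =
    M n.+1 z *m Tmx Phi kappa n z - Tmx Phi kappa n z *m M n z.
Proof.
move=> [//|n] z _ z1 zA.
apply: (zero_curvature hnu hPhi zA) => //; first exact/eqP.
- exact: hM.
- exact: hM.
Qed.
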